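(* Let $q$ be a prime power, let $\ell$ be a positive integer, and let $P\subseteq[0,q-2]^2$ be an integral convex polytope which is lattice equivalent to $\ell\Delta+\ell[0,e_1]+\ell[0,e_2]$. Then the toric code $C_P$ over $\mathbb{F}_q$ has minimum distance $$d(C_P)=(q-1-2\ell)(q-1-\ell).$$
   Context: An integral convex polytope (lattice polytope) in $\mathbb{R}^2$ is the convex hull of a nonempty finite subset of $\mathbb{Z}^2$. $e_1,e_2$ are the standard basis vectors, $[0,v]$ is the segment from $0$ to $v$, $\Delta=\operatorname{conv}\{(0,0),(1,0),(0,1)\}$, sums of polytopes are Minkowski sums, and $kA=\{ka:a\in A\}$. Two lattice polytopes $P,Q\subset\mathbb{R}^2$ are lattice equivalent if $T(P)=Q$ for some $T(x)=Ax+\lambda$ with $A\in\mathrm{GL}(2,\mathbb{Z})$, $\lambda\in\mathbb{Z}^2$. For a lattice polytope $P\subset\mathbb{R}^2$, $\mathcal{L}_P=\operatorname{span}_{\mathbb{F}_q}\{t^\alpha:\alpha\in P\cap\mathbb{Z}^2\}\subset\mathbb{F}_q[t_1^{\pm1},t_2^{\pm1}]$, and the toric code $C_P\subseteq\mathbb{F}_q^{(q-1)^2}$ is the image of the evaluation map $f\mapsto(f(\gamma))_{\gamma\in(\mathbb{F}_q^\times)^2}$ on $\mathcal{L}_P$. The minimum distance $d(C)$ of a linear code $C$ is the minimum number of nonzero entries of a nonzero element of $C$. *)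

(* Defs.v *)
From HB Require Import structures.
From mathcomp Require Import all_boot all_order all_algebra all_fingroup.
From mathcomp Require Import boolp classical_sets cardinality reals.
From mathcomp.multinomials Require Import monalg.

Set Implicit Arguments.
Unset Strict Implicit.
Unset Printing Implicit Defensive.

Import Order.TTheory GRing.Theory Num.Theory.
Local Open Scope classical_set_scope.
Local Open Scope ring_scope.

Definition lspan (K : pzRingType) (V : lmodType K) (S : set V) : set V :=
  [set v | exists n (c : 'I_n -> K) (u : 'I_n -> V),
     (forall i, S (u i)) /\ v = \sum_i c i *: u i].

Definition conv_hull (R : numDomainType) (V : lmodType R) (S : set V) : set V :=
  [set v | exists n (c : 'I_n -> R) (u : 'I_n -> V),
     [/\ forall i, S (u i), forall i, 0 <= c i, \sum_i c i = 1
       & v = \sum_i c i *: u i]].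

Definition segment (R : numDomainType) (V : lmodType R) (a b : V) : set V :=
  conv_hull [set a; b].

Definition dilate (R : pzRingType) (V : lmodType R) (k : R) (A : set V) : set V :=
  [set k *: a | a in A].

Definition minkowski_sum (V : nmodType) (A B : set V) : set V :=
  [set a + b | a in A & b in B].

Section Polytopes.
Variable R : realType.

Definition of_lattice (z : 'cV[int]_2) : 'cV[R]_2 := map_mx intr z.

Definition lattice_polytope (P : set 'cV[R]_2) : Prop :=
  exists S : set 'cV[int]_2,
    [/\ finite_set S, S !=set0 & P = conv_hull (of_lattice @` S)].

(* Over int, unitmx is exactly the set of matrices of determinant 1 or -1. *)
Definition lattice_equivalent (P Q : set 'cV[R]_2) : Prop :=
  exists (A : 'M[int]_2) (lambda : 'cV[int]_2),
    A \in unitmx /\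
    [set map_mx intr A *m x + of_lattice lambda | x in P] = Q.

Definition e1 : 'cV[R]_2 := delta_mx 0 0.
Definition e2 : 'cV[R]_2 := delta_mx 1 0.

Definition Delta : set 'cV[R]_2 := conv_hull [set 0; e1; e2].

Definition box (a b : R) : set 'cV[R]_2 := [set x | forall i, a <= x i 0 <= b].

End Polytopes.

Arguments Delta : clear implicits.

Section Codes.
Variables (I : finType) (F : finFieldType).

Definition hweight (w : {ffun I -> F}) : nat := #|[pred i | w i != 0]|.

(* The initial value #|I| is an upper bound of all weights, so it only matters
   for a code with no nonzero word: see min_distanceP. *)
Definition min_distance (C : set {ffun I -> F}) : nat :=
  \big[minn/#|I|]_(w : {ffun I -> F} | (w \in C) && (w != 0)) hweight w.

Lemma min_distanceP (C : set {ffun I -> F}) (d : nat) :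
  (exists2 w, C w & w != 0) ->
  min_distance C = d <->
  (exists w, [/\ C w, w != 0 & hweight w = d]) /\
  (forall w, C w -> w != 0 -> (d <= hweight w)%N).
Proof.
move=> [w0 Cw0 nz0].
have le_min w : C w -> w != 0 -> (min_distance C <= hweight w)%N.
  move=> Cw nz; rewrite /min_distance -minEnat -leEnat.
  by apply: bigmin_le_cond; rewrite nz andbT; apply: mem_set.
have [w1 [Cw1 nz1 w1E]] :
    exists w, [/\ C w, w != 0 & hweight w = min_distance C].
  case: (@arg_minnP _ w0 (fun w => (w \in C) && (w != 0)) hweight).
    by rewrite nz0 andbT; apply: mem_set.
  move=> w /andP[/set_mem Cw nz] wmin; exists w; split=> //.
  apply/eqP; rewrite eqn_leq le_min // andbT /min_distance.
  apply: (big_ind (fun m => hweight w <= m)%N) => [|a b wa wb|//].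
    exact: max_card.
  by rewrite leq_min wa.
split=> [<-|[[w [Cw nz <-]] wmin]]; first by split=> //; exists w1.
by apply/eqP; rewrite eqn_leq le_min //= -w1E wmin.
Qed.

End Codes.

Section ToricCodes.
Variables (R : realType) (F : finFieldType).

(* A Laurent polynomial in two variables is a finitely supported family of
   coefficients indexed by its exponents in Z^2; << alpha >> is t^alpha. Only
   the F-linear structure is available: monalg gives a product only for
   exponent monoids without nontrivial units, which Z^2 is not. *)
Definition laurent : Type := {malg F['cV[int]_2]}.
HB.instance Definition _ := GRing.Lmodule.on laurent.

Definition torus : finType := ({unit F} * {unit F})%type.

Definition monom_eval (g : torus) (alpha : 'cV[int]_2) : F :=
  FinRing.uval g.1 ^ alpha 0 0 * FinRing.uval g.2 ^ alpha 1 0.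

Definition evaluation (f : laurent) : {ffun torus -> F} :=
  [ffun g => mmap idfun (monom_eval g) f].

Definition laurent_space (P : set 'cV[R]_2) : set laurent :=
  lspan [set (<< alpha >> : laurent) | alpha in [set alpha | P (of_lattice R alpha)]].

Definition toric_code (P : set 'cV[R]_2) : set {ffun torus -> F} :=
  evaluation @` laurent_space P.

End ToricCodes.

Arguments toric_code {R} F P.

(* Main.v *)
Require Import Defs.
From HB Require Import structures.
From mathcomp Require Import all_boot all_order all_algebra all_fingroup.
From mathcomp Require Import boolp classical_sets cardinality reals.
From mathcomp Require Import zify ring lra.
From mathcomp.multinomials Require Import monalg.

Set Implicit Arguments.
Unset Strict Implicit.
Unset Printing Implicit Defensive.

Import Order.TTheory GRing.Theory Num.Theory.
Local Open Scope classical_set_scope.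
Local Open Scope ring_scope.

(** Write [n = q - 1] for the order of the multiplicative group, and [Q] for
    the polytope [l Delta + l [0,e1] + l [0,e2]], the pentagon
    [0 <= x, y <= 2 l, x + y <= 3 l].

    A unimodular map [A] from [P] onto [Q] induces a monomial substitution on
    the torus, which is a bijection because [A] is invertible over the integers;
    the translation part multiplies a word by a monomial, which never vanishes.
    Hence [C_P] and [C_Q] have the same weights
    ([exponent_code_affine]), and only the code of the pentagon matters. The
    box enters once: a unimodular image of the edge of length [2 l] of [Q] lies
    in [[0, q - 2]^2], so [2 l <= n - 1] ([unimodular_segment_in_box]).

    The lower bound is the footprint bound. Let [x^a y^b] be the leading
    monomial of a nonzero polynomial for the lexicographic order. Its
    coefficient of [x^a] is a polynomial of degree [b] in [y], so it is nonzero
    for at least [n - b] values of [y], and for each of them at least [n - a]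
    values of [x] are not roots: at least [(n - a) (n - b)] points of the torus
    are not zeros ([footprint_bound]). As [(a, b)] is in [Q], this product is
    smallest at the vertices [(2 l, l)] and [(l, 2 l)]
    ([pentagon_footprint]), where it is [(n - 2 l) (n - l)].

    The bound is attained by the product of [2 l] distinct factors [x - s] and
    [l] distinct factors [y - t], whose exponents fill the rectangle
    [[0, 2 l] x [0, l]] contained in [Q] ([exponent_code_rectangle]). *)

(** * Codes spanned by monomials *)

Lemma hweight_gt0 (I : finType) (F : finFieldType) (w : {ffun I -> F}) :
  (0 < hweight w)%N = (w != 0).
Proof.
rewrite lt0n; congr (~~ _); apply/eqP/eqP => [w0|->].
  apply/ffunP => i; rewrite ffunE; have /(_ i) := card0_eq w0.
  by rewrite !inE => /negbFE/eqP.
by apply/eq_card0 => i; rewrite !inE ffunE eqxx.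
Qed.

Section ExponentCode.
Variable F : finFieldType.
Implicit Types (S T : set 'cV[int]_2) (w : {ffun torus F -> F}).

(** The toric code of a set of exponents, given by the values of its words
    rather than by Laurent polynomials; the exponents in a sum may repeat. *)
Definition exponent_code S : set {ffun torus F -> F} :=
  [set w | exists n (c : 'I_n -> F) (u : 'I_n -> 'cV[int]_2),
     (forall i, S (u i)) /\ forall g, w g = \sum_i c i * monom_eval g (u i)].

Lemma evaluation_sum n (c : 'I_n -> F) (u : 'I_n -> 'cV[int]_2) (g : torus F) :
  evaluation (\sum_i c i *: (<< u i >> : laurent F)) g =
  \sum_i c i * monom_eval g (u i).
Proof.
rewrite ffunE raddf_sum; apply: eq_bigr => i _.
have -> : c i *: (<< u i >> : laurent F) = << c i *g u i >>.
  by apply/malgP => k; rewrite mcoeffZ !mcoeffU mulrnAr mulr1.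
exact: mmapU.
Qed.

Lemma toric_codeE (R : realType) (P : set 'cV[R]_2) :
  toric_code F P = exponent_code [set alpha | P (of_lattice R alpha)].
Proof.
apply/seteqP; split => w.
  move=> [f [n [c [v [Sv ->]]]] <-].
  have /boolp.choice[u uP] : forall i, exists alpha,
      P (of_lattice R alpha) /\ (<< alpha >> : laurent F) = v i.
    by move=> i; have [alpha Pa <-] := Sv i; exists alpha.
  exists n, c, u; split.
    by move=> i; have [] := uP i.
  move=> g; rewrite -evaluation_sum; congr (evaluation _ g).
  by apply: eq_bigr => i _; have [_ <-] := uP i.
move=> [n [c [u [Pu wE]]]].
exists (\sum_i c i *: (<< u i >> : laurent F)).
  by exists n, c, (fun i => << u i >>); split=> // i; exists (u i).
by apply/ffunP => g; rewrite evaluation_sum wE.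
Qed.

Lemma exponent_code_sum S (I : finType) (c : I -> F) (u : I -> 'cV[int]_2) :
  (forall i, S (u i)) ->
  exponent_code S [ffun g => \sum_i c i * monom_eval g (u i)].
Proof.
move=> Su; exists #|I|, (c \o enum_val), (u \o enum_val); split=> [i|g] //=.
by rewrite ffunE -(big_enum_val (fun i => c i * monom_eval g (u i))).
Qed.

(** * Monomial substitutions on the torus *)

Lemma uval_neq0 (x : {unit F}) : FinRing.uval x != 0.
Proof. by rewrite -unitfE; case: x. Qed.

Lemma monom_eval_unit (g : torus F) alpha :
  monom_eval g alpha \is a GRing.unit.
Proof. by rewrite unitfE mulf_neq0 // expfz_neq0 // uval_neq0. Qed.

Lemma monom_evalD (g : torus F) alpha beta :
  monom_eval g (alpha + beta) = monom_eval g alpha * monom_eval g beta.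
Proof. by rewrite /monom_eval !mxE !expfzDr ?uval_neq0 // mulrACA. Qed.

Definition torus_pow (M : 'M[int]_2) (g : torus F) : torus F :=
  (FinRing.unit F (monom_eval_unit g (col 0 M)),
   FinRing.unit F (monom_eval_unit g (col 1 M))).

(** The columns, not the rows, of [M] define [torus_pow M] precisely so that
    the substitution acts on exponents by [M] itself and not by its
    transpose. *)
Lemma monom_eval_pow M g alpha :
  monom_eval (torus_pow M g) alpha = monom_eval g (M *m alpha).
Proof.
have mulE (i : 'I_2) : (M *m alpha) i 0 = M i 0 * alpha 0 0 + M i 1 * alpha 1 0.
  rewrite mxE big_ord_recl big_ord1.
  by congr (_ + M _ _ * alpha _ _); apply/val_inj.
rewrite /monom_eval !mulE /= /monom_eval !mxE !expfzMl !exprz_exp.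
by rewrite !expfzDr ?uval_neq0 // mulrACA.
Qed.

Lemma torus_powK M N : M *m N = 1%:M -> cancel (torus_pow M) (torus_pow N).
Proof.
move=> MN1 g.
have comp j :
    monom_eval (torus_pow M g) (col j N) = monom_eval g (col j 1%:M).
  by rewrite monom_eval_pow -MN1 colE mulmxA -colE.
case: g comp => x y comp; congr pair; apply: val_inj; rewrite /= comp.
  by rewrite /monom_eval !mxE /= mulr1.
by rewrite /monom_eval !mxE /= mul1r.
Qed.

(** If [w] is the word of [f], the word [w'] is that of [t^mu f(t^M)]. The
    factor [t^mu] has no zero and [g |-> g^M] permutes the torus, so [w'] has as
    many zeros as [w]. *)
Lemma exponent_code_affine S T (M : 'M[int]_2) (mu : 'cV[int]_2) w :
  M \in unitmx -> (forall alpha, S alpha -> T (M *m alpha + mu)) ->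
  exponent_code S w ->
  exists2 w', exponent_code T w' & hweight w' = hweight w.
Proof.
move=> uM ST [n [c [u [Su wE]]]].
exists [ffun h => \sum_i c i * monom_eval h (M *m u i + mu)].
  by apply: exponent_code_sum => i; apply/ST/Su.
have powI : injective (torus_pow M) := can_inj (torus_powK (mulmxV uM)).
rewrite /hweight -[RHS]cardsE -[RHS](card_preimset _ powI).
rewrite -[LHS]cardsE; apply: eq_card => h; rewrite !inE ffunE wE.
have -> : \sum_i c i * monom_eval h (M *m u i + mu) =
    monom_eval h mu * \sum_i c i * monom_eval (torus_pow M h) (u i).
  rewrite mulr_sumr; apply: eq_bigr => i _.
  by rewrite monom_evalD monom_eval_pow mulrA mulrC.
by rewrite mulf_eq0 negb_or -unitfE monom_eval_unit.
Qed.

(** * The footprint bound *)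

Lemma card_nonroots (r : {poly F}) : r != 0 ->
  (#|{: {unit F}}| - (size r).-1 <=
   #|[pred x : {unit F} | r.[FinRing.uval x] != 0%R]|)%N.
Proof.
move=> r0; rewrite leq_subLR addnC.
rewrite -(cardC [pred x : {unit F} | r.[FinRing.uval x] != 0]) leq_add2l.
rewrite cardE -(size_map FinRing.uval) -ltnS prednK ?size_poly_gt0 //.
apply: max_poly_roots => //.
  by apply/allP => _ /mapP[x + ->]; rewrite mem_enum !inE negbK.
by rewrite map_inj_uniq ?enum_uniq //; apply: val_inj.
Qed.

(** A polynomial in [x] with coefficients in [F[y]] is evaluated at [y] outside
    the roots of its leading coefficient: there the degree in [x] does not
    drop, and the number of roots in [x] is bounded by that degree. *)
Lemma footprint_bound (p : {poly {poly F}}) : p != 0 ->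
  ((#|{: {unit F}}| - (size p).-1) *
   (#|{: {unit F}}| - (size (lead_coef p)).-1) <=
   #|[pred g : torus F |
       p.[(FinRing.uval g.1)%:P].[FinRing.uval g.2] != 0%R]|)%N.
Proof.
move=> p0; pose Y := [pred y : {unit F} | (lead_coef p).[FinRing.uval y] != 0].
have geY : (#|{: {unit F}}| - (size (lead_coef p)).-1 <= #|Y|)%N.
  by apply: card_nonroots; rewrite lead_coef_eq0.
rewrite mulnC; apply: leq_trans (leq_mul geY (leqnn _)) _.
have -> : #|[pred g : torus F |
      p.[(FinRing.uval g.1)%:P].[FinRing.uval g.2] != 0%R]| =
    (\sum_(x : {unit F}) \sum_(y : {unit F})
      if p.[(FinRing.uval x)%:P].[FinRing.uval y] != 0%R then 1 else 0)%N.
  by rewrite pair_bigA -sum1_card big_mkcond.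
rewrite exchange_big /= -sum_nat_const big_mkcond /=.
apply: leq_sum => y _; case: ifP => // Yy.
pose r := map_poly (horner_eval (FinRing.uval y)) p.
have rE x : p.[x%:P].[FinRing.uval y] = r.[x].
  by rewrite -[x in RHS](hornerC x (FinRing.uval y)) /r -horner_evalE horner_map.
have sr : size r = size p by apply: size_map_poly_id0.
have r0 : r != 0 by rewrite -size_poly_gt0 sr size_poly_gt0.
rewrite -sr -big_mkcond /= sum1_card; apply: leq_trans (card_nonroots r0) _.
by apply/eq_leq/eq_card => x; rewrite [LHS]inE -rE.
Qed.

(** The exponent found is that of the lexicographic leading monomial of a
    polynomial in two variables with the values of [w]. *)
Lemma hweight_exponent_code S w :
  (forall alpha, S alpha -> forall i, 0 <= alpha i 0) ->
  exponent_code S w -> w != 0 ->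
  exists2 alpha, S alpha &
    ((#|{: {unit F}}| - `|alpha 0%R 0%R|) *
     (#|{: {unit F}}| - `|alpha 1%R 0%R|) <= hweight w)%N.
Proof.
move=> S_ge0 [n [c [u [Su wE]]]] w0.
pose p : {poly {poly F}} :=
  \sum_i (c i *: 'X^(`|u i 1 0|)) *: 'X^(`|u i 0 0|).
have pE (g : torus F) : w g = p.[(FinRing.uval g.1)%:P].[FinRing.uval g.2].
  rewrite wE /p !horner_sum; apply: eq_bigr => i _.
  rewrite /monom_eval -[u i 0 0]gez0_abs ?S_ge0 // -[u i 1 0]gez0_abs ?S_ge0 //.
  by rewrite !absz_nat -!exprnP !hornerE mulrAC.
have p0 : p != 0.
  apply: contra w0 => /eqP p0; apply/eqP/ffunP => g.
  by rewrite pE p0 !hornerE ffunE.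
have: (lead_coef p)`_(size (lead_coef p)).-1 != 0.
  by rewrite -lead_coefE !lead_coef_eq0.
rewrite {1}/lead_coef {1}/p !coef_sum => /eqP lc0.
(* A nonzero sum of coefficients has a nonzero term, so some exponent of the
   word is the leading one. *)
have [i /eqP ci0] : exists i : 'I_n,
   ((c i *: 'X^(`|u i 1 0|)) *: 'X^(`|u i 0 0|) : {poly {poly F}})`_(size p).-1`_
     (size (lead_coef p)).-1 <> 0.
  apply: contra_notP lc0 => /forallNP lc0.
  by rewrite big1 // => i _; apply: contrapT; apply: lc0.
exists (u i) => //.
move: ci0; rewrite coefZ coefXn.
case: (_ =P absz (u i 0 0)) => [ua|_]; last by rewrite mulr0 coef0 eqxx.
rewrite mulr1 coefZ coefXn.
case: (_ =P absz (u i 1 0)) => [ub _|_]; last by rewrite mulr0 eqxx.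
rewrite -ua -ub; apply: leq_trans (footprint_bound p0) _.
by apply/eq_leq/eq_card => g; rewrite [LHS]inE -pE.
Qed.

(** * A word with many zeros *)

(** The word of a product of [a] distinct factors [x - s] and [b] distinct
    factors [y - t], with [s] and [t] on the torus. *)
Lemma exponent_code_rectangle S (a b : nat) :
  (a <= #|{: {unit F}}|)%N -> (b <= #|{: {unit F}}|)%N ->
  (forall alpha : 'cV[int]_2,
     0 <= alpha 0 0 <= a%:Z -> 0 <= alpha 1 0 <= b%:Z -> S alpha) ->
  exists2 w, exponent_code S w &
    hweight w = ((#|{: {unit F}}| - a) * (#|{: {unit F}}| - b))%N.
Proof.
move=> le_a le_b rectS.
have split_poly k : (k <= #|{: {unit F}}|)%N ->
    exists2 p : {poly F}, size p = k.+1 &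
    #|[pred x : {unit F} | p.[FinRing.uval x] != 0]| = (#|{: {unit F}}| - k)%N.
  move=> le_k.
  have sz : size (take k (enum {: {unit F}})) = k.
    by apply: size_takel; rewrite -cardE.
  set s := take k _ in sz.
  have us : uniq s by apply: take_uniq; apply: enum_uniq.
  exists (\prod_(x <- s) ('X - (FinRing.uval x)%:P)).
    by rewrite size_prod_XsubC sz.
  rewrite -(cardC (mem s)) (card_uniqP us) sz addKn.
  apply: eq_card => x; rewrite !inE horner_prod prodf_seq_neq0.
  apply/allP/idP => [nz|xs y ys].
    by apply/negP => /nz; rewrite !hornerE subrr eqxx.
  rewrite !hornerE subr_eq0; apply: contraNneq xs => /val_inj ->.
  exact: ys.
have [p sp cp] := split_poly _ le_a; have [r sr cr] := split_poly _ le_b.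
pose u (ij : 'I_a.+1 * 'I_b.+1) : 'cV[int]_2 :=
  \col_k (if k == 0 then (ij.1 : nat)%:Z else (ij.2 : nat)%:Z).
exists [ffun g => \sum_(ij : 'I_a.+1 * 'I_b.+1)
      (p`_ij.1 * r`_ij.2) * monom_eval g (u ij)].
  apply: exponent_code_sum => -[i j]; apply: rectS; rewrite mxE /=.
    by rewrite lez_nat -ltnS ltn_ord.
  by rewrite lez_nat -ltnS ltn_ord.
rewrite -cp -cr -cardX; apply: eq_card => -[x y]; rewrite !inE ffunE /=.
have -> : \sum_(ij : 'I_a.+1 * 'I_b.+1)
      (p`_ij.1 * r`_ij.2) * monom_eval (x, y) (u ij) =
    p.[FinRing.uval x] * r.[FinRing.uval y].
  rewrite !horner_coef sp sr big_distrlr pair_bigA /=.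
  by apply: eq_bigr => -[i j] _; rewrite /monom_eval !mxE /= -!exprnP mulrACA.
by rewrite mulf_eq0 negb_or.
Qed.

End ExponentCode.

(** * The pentagon *)

Section Pentagon.
Variable R : realType.
Implicit Types (S T : set 'cV[R]_2) (a b k : R).

(** The inequalities of the pentagon are obtained from those of the three
    summands: valid linear inequalities pass to convex hulls, scale under
    dilation and add up under Minkowski sum. *)
Definition half_plane a b k : set 'cV[R]_2 :=
  [set v | a * v 0 0 + b * v 1 0 <= k].

Lemma conv_hull_half_plane S a b k :
  S `<=` half_plane a b k -> conv_hull S `<=` half_plane a b k.
Proof.
move=> Sh _ [n [c [u [Su c0 c1 ->]]]].
rewrite /half_plane /= !summxE !mulr_sumr -big_split /=.
rewrite -[k]mul1r -c1 mulr_suml; apply: ler_sum => i _.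
rewrite !mxE; have := ler_wpM2l (c0 i) (Sh _ (Su i)); lra.
Qed.

Lemma dilate_half_plane S a b k (m : R) : 0 <= m ->
  S `<=` half_plane a b k -> dilate m S `<=` half_plane a b (m * k).
Proof.
move=> m0 Sh _ [v Sv <-]; rewrite /half_plane /= !mxE.
have := ler_wpM2l m0 (Sh _ Sv); lra.
Qed.

Lemma minkowski_sum_half_plane S T a b k k' :
  S `<=` half_plane a b k -> T `<=` half_plane a b k' ->
  minkowski_sum S T `<=` half_plane a b (k + k').
Proof.
move=> Sh Th _ [v Sv [v' Tv' <-]]; rewrite /half_plane /= !mxE.
have := Sh _ Sv; have := Th _ Tv'; rewrite /half_plane /=; lra.
Qed.

Lemma scale_in_conv_hull S (v : 'cV[R]_2) (t : R) :
  S 0 -> S v -> 0 <= t <= 1 -> conv_hull S (t *: v).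
Proof.
move=> S0 Sv /andP[t0 t1].
exists 2%N, (fun i => if i == 0 then t else 1 - t),
  (fun i => if i == 0 then v else 0).
split=> [i|i||]; first by case: ifP.
- by case: ifP => // _; rewrite subr_ge0.
- by rewrite big_ord_recl big_ord1 /= subrKC.
- by rewrite big_ord_recl big_ord1 /= scaler0 addr0.
Qed.

Definition pentagon (l : nat) : set 'cV[R]_2 :=
  minkowski_sum
    (minkowski_sum (dilate l%:R (Delta R))
                   (dilate l%:R (segment 0 (e1 R))))
    (dilate l%:R (segment 0 (e2 R))).

Lemma pentagon_half_plane l a b k k1 k2 :
  [/\ 0 <= k, a <= k & b <= k] -> [/\ 0 <= k1, a <= k1, 0 <= k2 & b <= k2] ->
  pentagon l `<=` half_plane a b (l%:R * (k + k1 + k2)).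
Proof.
move=> [k_ge0 ak bk] [k1_ge0 ak1 k2_ge0 bk2]; rewrite !mulrDr.
apply: minkowski_sum_half_plane; first apply: minkowski_sum_half_plane.
all: apply: dilate_half_plane; first exact: ler0n.
all: apply: conv_hull_half_plane.
- by move=> v [[->|->]|->]; rewrite /half_plane /= !mxE /=; lra.
- by move=> v [->|->]; rewrite /half_plane /= !mxE /=; lra.
- by move=> v [->|->]; rewrite /half_plane /= !mxE /=; lra.
Qed.

Lemma pentagon_bounds l v : pentagon l v ->
  [/\ 0 <= v 0 0 <= 2 * l%:R, 0 <= v 1 0 <= 2 * l%:R
    & v 0 0 + v 1 0 <= 3 * l%:R].
Proof.
move=> Qv.
have Qh a b k k1 k2 : [/\ 0 <= k, a <= k & b <= k] ->
    [/\ 0 <= k1, a <= k1, 0 <= k2 & b <= k2] ->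
    a * v 0 0 + b * v 1 0 <= l%:R * (k + k1 + k2).
  by move=> hk hk12; apply: pentagon_half_plane Qv.
have left_edge : -1 * v 0 0 + 0 * v 1 0 <= l%:R * (0 + 0 + 0).
  by apply: Qh; split; lra.
have bottom_edge : 0 * v 0 0 + -1 * v 1 0 <= l%:R * (0 + 0 + 0).
  by apply: Qh; split; lra.
have right_edge : 1 * v 0 0 + 0 * v 1 0 <= l%:R * (1 + 1 + 0).
  by apply: Qh; split; lra.
have top_edge : 0 * v 0 0 + 1 * v 1 0 <= l%:R * (1 + 0 + 1).
  by apply: Qh; split; lra.
have slanted_edge : 1 * v 0 0 + 1 * v 1 0 <= l%:R * (1 + 1 + 1).
  by apply: Qh; split; lra.
split; lra.
Qed.

(** Half of the first coordinate comes from the triangle and half from the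
    horizontal segment; the second coordinate comes from the vertical
    segment. *)
Lemma rectangle_sub_pentagon l (v : 'cV[R]_2) : (0 < l)%N ->
  0 <= v 0 0 <= 2 * l%:R -> 0 <= v 1 0 <= l%:R -> pentagon l v.
Proof.
move=> l_gt0 v0 v1; have l0 : 0 < l%:R :> R by rewrite ltr0n.
pose t := v 0 0 / (2 * l%:R); pose s := v 1 0 / l%:R.
have t01 : 0 <= t <= 1 by rewrite divr_ge0 ?ler_pdivrMr; lra.
have s01 : 0 <= s <= 1 by rewrite divr_ge0 ?ler_pdivrMr; lra.
exists (l%:R *: (t *: e1 R) + l%:R *: (t *: e1 R)).
  exists (l%:R *: (t *: e1 R)).
    by exists (t *: e1 R) => //; apply: scale_in_conv_hull => //; left; [left|right].
  exists (l%:R *: (t *: e1 R)) => //.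
  by exists (t *: e1 R) => //; apply: scale_in_conv_hull => //; [left|right].
exists (l%:R *: (s *: e2 R)).
  by exists (s *: e2 R) => //; apply: scale_in_conv_hull => //; [left|right].
apply/colP => i; rewrite !mxE; have [->|->] : i = 0 \/ i = 1.
- by case: i => -[|[|//]] p; [left|right]; apply: val_inj.
- by rewrite /= /t; field; lra.
- by rewrite /= /s; field; lra.
Qed.

Lemma pentagon_lattice_points l (alpha : 'cV[int]_2) :
  pentagon l (of_lattice R alpha) ->
  [/\ 0 <= alpha 0 0 <= 2 * l%:Z, 0 <= alpha 1 0 <= 2 * l%:Z
    & alpha 0 0 + alpha 1 0 <= 3 * l%:Z].
Proof.
move=> /pentagon_bounds; rewrite !mxE -!(ler_int R) !(rmorphM, rmorphD) /=.
by rewrite -!pmulrn.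
Qed.

Lemma rectangle_lattice_points l (alpha : 'cV[int]_2) : (0 < l)%N ->
  0 <= alpha 0 0 <= (2 * l)%N%:Z -> 0 <= alpha 1 0 <= l%:Z ->
  pentagon l (of_lattice R alpha).
Proof.
move=> l_gt0; rewrite -!(ler_int R) -!pmulrn natrM => a0 a1.
by apply: rectangle_sub_pentagon; rewrite ?mxE.
Qed.

(** * Lattice equivalence *)

(** A lattice equivalence matches lattice points with lattice points, since
    the inverse of a unimodular matrix is again an integer matrix. *)
Lemma lattice_equivalent_points (P Q : set 'cV[R]_2) :
  lattice_equivalent P Q ->
  exists (A : 'M[int]_2) (lambda mu : 'cV[int]_2),
  [/\ A \in unitmx,
      forall alpha, P (of_lattice R alpha) ->
        Q (of_lattice R (A *m alpha + lambda))
    & forall beta, Q (of_lattice R beta) ->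
        P (of_lattice R (invmx A *m beta + mu))].
Proof.
move=> [A [lambda [uA PQ]]]; exists A, lambda, (- (invmx A *m lambda)).
split=> // [alpha Pa|beta].
  rewrite -PQ; exists (of_lattice R alpha) => //.
  by rewrite /of_lattice map_mxD map_mxM.
rewrite -PQ => -[x Px xE].
suff -> : of_lattice R (invmx A *m beta - invmx A *m lambda) = x by [].
have := congr1 (mulmx (map_mx intr (invmx A))) xE.
rewrite mulmxDr mulmxA -map_mxM mulVmx // map_mx1 mul1mx -!map_mxM => xE'.
by rewrite /of_lattice map_mxD map_mxN -xE' addrK.
Qed.

(** The first column of [B] has a nonzero integer entry, and the corresponding
    coordinates of the two endpoints differ by at least [m] in absolute
    value. *)
Lemma unimodular_segment_in_box (B : 'M[int]_2) (mu : 'cV[int]_2) (m : nat) k :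
  B \in unitmx -> box 0 k (of_lattice R mu) ->
  box 0 k (of_lattice R (B *m (m%:Z *: delta_mx 0 0) + mu)) -> m%:R <= k.
Proof.
move=> uB box0 box1.
have [i Bi0] : exists i, B i 0 != 0.
  apply/not_existsP => B0.
  have := congr1 (fun M : 'M_2 => M 0 0) (mulVmx uB).
  rewrite !mxE big1 // => j _.
  by have /negP := B0 j; rewrite negbK => /eqP ->; rewrite mulr0.
have := box1 i; have := box0 i.
have -> : of_lattice R (B *m (m%:Z *: delta_mx 0 0) + mu) i 0 =
    m%:R * (B i 0)%:~R + (mu i 0)%:~R.
  by rewrite -scalemxAr -colE !mxE rmorphD rmorphM.
rewrite mxE => /andP[lo0 hi0] /andP[lo1 hi1].
have le_k : m%:R * `|(B i 0)%:~R| <= k.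
  by rewrite -[m%:R]normr_nat -normrM ler_norml; apply/andP; split; lra.
have B1 : 1 <= `|(B i 0)%:~R| :> R.
  by rewrite -intr_norm ler1z -gtz0_ge1 normr_gt0.
by apply: le_trans le_k; rewrite -[leLHS]mulr1 ler_wpM2l.
Qed.

End Pentagon.
Arguments pentagon : clear implicits.

(** With [m = n - 2 l], [s = 2 l - a] and [t = 2 l - b], the slanted edge says
    [l <= s + t], so that [(m + s) (m + t) >= m^2 + m (s + t) >= m (m + l)]. *)
Lemma pentagon_footprint (n l a b : nat) :
  (2 * l <= n)%N -> (a <= 2 * l)%N -> (b <= 2 * l)%N -> (a + b <= 3 * l)%N ->
  ((n - 2 * l) * (n - l) <= (n - a) * (n - b))%N.
Proof.
move=> ln al bl abl; pose m := (n - 2 * l)%N.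
pose s := (2 * l - a)%N; pose t := (2 * l - b)%N.
have -> : (n - l = m + l)%N by rewrite /m; lia.
have -> : (n - a = m + s)%N by rewrite /m /s; lia.
have -> : (n - b = m + t)%N by rewrite /m /t; lia.
have : (l <= s + t)%N by rewrite /s /t; lia.
rewrite -/m; nia.
Qed.

(** * The minimum distance *)

Theorem corollary5p9 (R : realType) (q : nat) (F : finFieldType)
    (hq : #|F| = q) (l : nat) (l_gt0 : (0 < l)%N) (P : set 'cV[R]_2)
    (polyP : lattice_polytope P)
    (boxP : P `<=` box 0 (q%:R - 2))
    (eqvP : lattice_equivalent P
      (minkowski_sum
        (minkowski_sum (dilate l%:R (Delta R))
                       (dilate l%:R (segment 0 (e1 R))))
        (dilate l%:R (segment 0 (e2 R))))) :
  (min_distance (toric_code F P))%:Z =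
    (q%:Z - 1 - 2 * l%:Z) * (q%:Z - 1 - l%:Z).
Proof.
have [A [lambda [mu [uA PtoQ QtoP]]]] := lattice_equivalent_points eqvP.
rewrite -/(pentagon R l) in PtoQ QtoP.
have uB : invmx A \in unitmx by rewrite unitmx_inv.
have card_unit : #|{: {unit F}}| = q.-1.
  by rewrite -hq -card_finField_unit cardsT.
have q_ge : (2 * l + 2 <= q)%N.
  have Q0 : pentagon R l (of_lattice R 0).
    by apply: rectangle_lattice_points; rewrite // !mxE.
  have Q1 : pentagon R l (of_lattice R ((2 * l)%N%:Z *: delta_mx 0 0)).
    by apply: rectangle_lattice_points;
      rewrite // !mxE /= ?mulr1 ?mulr0 ?lexx.
  have /boxP box0 := QtoP _ Q0; have /boxP box1 := QtoP _ Q1.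
  rewrite mulmx0 add0r in box0.
  have := unimodular_segment_in_box uB box0 box1.
  by rewrite lerBrDr -natrD ler_nat.
pose expP : set 'cV[int]_2 := [set alpha | P (of_lattice R alpha)].
pose expQ : set 'cV[int]_2 := [set alpha | pentagon R l (of_lattice R alpha)].
have [w0 Qw0 w0E] : exists2 w : {ffun torus F -> F}, exponent_code expQ w &
    hweight w = ((q.-1 - 2 * l) * (q.-1 - l))%N.
  rewrite -card_unit; apply: exponent_code_rectangle; rewrite ?card_unit.
  - lia.
  - lia.
  - by move=> alpha; apply: rectangle_lattice_points.
have [w1 Pw1] := exponent_code_affine uB (T := expP) QtoP Qw0.
rewrite w0E => w1E.
have w1_neq0 : w1 != 0 by rewrite -hweight_gt0 w1E muln_gt0; lia.
suff -> : min_distance (toric_code F P) = ((q.-1 - 2 * l) * (q.-1 - l))%N by lia.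
rewrite toric_codeE; apply/min_distanceP; first by exists w1.
split; first by exists w1.
move=> w Pw; have [w' Qw' ww'] := exponent_code_affine uA (T := expQ) PtoQ Pw.
rewrite -hweight_gt0 -ww' hweight_gt0 => w'_neq0.
have expQ_ge0 alpha : expQ alpha -> forall i, 0 <= alpha i 0.
  move=> /pentagon_lattice_points[/andP[a0 _] /andP[a1 _] _] i.
  have [->|->] // : i = 0 \/ i = 1.
  by case: i => -[|[|//]] p; [left|right]; apply: val_inj.
have [alpha] := hweight_exponent_code expQ_ge0 Qw' w'_neq0.
move=> /pentagon_lattice_points[a0 a1 a01]; rewrite card_unit.
apply: leq_trans; apply: pentagon_footprint; lia.
Qed.
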